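(* Let $x,y,z$ be fixed roots of unity different from $1$. Let $\mathcal{E}^*\in\overline{\mathbb{Q}}[a,b,c,d]$ be the polynomial obtained from \[\mathcal{E}=B_2^2-A_1B_1B_2+(A_1^2-2A_2)B_2+A_2B_1^2-A_1A_2B_1+A_2^2\] by substituting \[A_1=\tfrac{y-x}{y-1}a+\tfrac{xy-1}{y-1}b,\quad A_2=xab,\quad B_1=\tfrac{z-x}{z-1}c+\tfrac{xz-1}{z-1}d,\quad B_2=xcd.\] Then $\mathcal{E}^*$ is irreducible in $\overline{\mathbb{Q}}[a,b,c,d]$, unless $x=y=z=-1$.
   Context: $a,b,c,d$ are independent variables. (For $x=y=z=-1$ one has $\mathcal{E}^*=(ab-cd)^2$.) *)

(* Defs.v *)
From HB Require Import structures.
From mathcomp Require Import all_boot all_order all_algebra all_field.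
From mathcomp Require Import mpoly.
Set Implicit Arguments. Unset Strict Implicit. Unset Printing Implicit Defensive.
Import Order.TTheory GRing.Theory Num.Theory.
Local Open Scope ring_scope.

Definition is_root_of_unity1 (x : algC) : Prop := exists n : nat, (0 < n)%N /\ x ^+ n = 1.

Definition irreducible_elt (R : idomainType) (p : R) : Prop :=
  p != 0 /\ p \isn't a GRing.unit /\
  forall q r : R, p = q * r -> q \is a GRing.unit \/ r \is a GRing.unit.

Definition Epoly (R : comRingType) (A1 A2 B1 B2 : R) : R :=
  B2 ^+ 2 - A1 * B1 * B2 + (A1 ^+ 2 - 2 * A2) * B2 + A2 * B1 ^+ 2
  - A1 * A2 * B1 + A2 ^+ 2.

Definition va : {mpoly algC[4]} := 'X_(inord 0).
Definition vb : {mpoly algC[4]} := 'X_(inord 1).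
Definition vc : {mpoly algC[4]} := 'X_(inord 2).
Definition vd : {mpoly algC[4]} := 'X_(inord 3).

Definition Estar (x y z : algC) : {mpoly algC[4]} :=
  Epoly (((y - x) / (y - 1))%:MP * va + ((x * y - 1) / (y - 1))%:MP * vb)
        (x%:MP * va * vb)
        (((z - x) / (z - 1))%:MP * vc + ((x * z - 1) / (z - 1))%:MP * vd)
        (x%:MP * vc * vd).

(* Main.v *)
Require Import Defs.
From HB Require Import structures.
From mathcomp Require Import all_boot all_order all_algebra all_field.
From mathcomp Require Import mpoly.
From mathcomp Require Import ring.
Import GRing.Theory Num.Theory.
Local Open Scope ring_scope.

(** Put [p = (y-x)/(y-1)], [q = (xy-1)/(y-1)] and define [r], [s] likewise from
    [z].  E is the resultant of [T^2 - A1 T + A2] and [T^2 - B1 T + B2], so as a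
    quadratic polynomial in [d], E* has discriminant [D1 * (x N)^2] with
      [D1 = (p a + q b)^2 - 4 x a b],  [N = r c^2 - (p a + q b) c + s a b].
    [D1] is not a square, since [p q - x = - y (x-1)^2 / (y-1)^2 != 0], and [N]
    vanishes only if [p = q = r = s = 0], that is [x = y = z = -1].  So if
    E* = f g, then [f] and [g] cannot both have degree 1 in [d]; by symmetry each
    of the four variables occurs in at most one of [f], [g].  Let [M], [M'] be the
    points obtained by exchanging, between P = (1,1,0,0) and P' = (0,0,1,1), the
    coordinates that do not occur in [f].  Then
      [E*(M) E*(M') = f(P) g(P') f(P') g(P) = E*(P) E*(P') != 0],
    while [E*(M) E*(M') = 0] as soon as the partition of the variables is
    nontrivial. *)

(** * Degree in a single variable, and dependence on a variable *)

Section PartialDegree.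
Context {F : fieldType} {n : nat}.
Implicit Types (f : {mpoly F[n]}) (i : 'I_n).

(** The coefficients stay in the full ring, although ['X_i] does not occur in them. Thus
    [size (poly_in i f) <= 1] encodes that [f] does not involve ['X_i]. *)
Definition poly_in i : {mpoly F[n]} -> {poly {mpoly F[n]}} :=
  mmap (polyC \o @mpolyC n F) (fun j => if j == i then 'X else ('X_j)%:P).

HB.instance Definition _ i := GRing.RMorphism.on (poly_in i).

Lemma poly_inC i c : poly_in i c%:MP = (c%:MP)%:P.
Proof. exact: mmapC. Qed.

Lemma poly_inX i j : poly_in i 'X_j = if j == i then 'X else ('X_j)%:P.
Proof. by rewrite /poly_in mmapX mmap1U. Qed.

Lemma mpoly_rmorph_ext (S : comNzRingType) (g h : {rmorphism {mpoly F[n]} -> S}) :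
    (forall c, g c%:MP = h c%:MP) -> (forall i, g 'X_i = h 'X_i) -> g =1 h.
Proof.
move=> eqC eqX f; rewrite (mpolyE f) !rmorph_sum; apply: eq_bigr => m _.
rewrite -mul_mpolyC !rmorphM eqC mpolyXE_id !rmorph_prod; congr (_ * _).
by apply: eq_bigr => i _; rewrite !rmorphXn eqX.
Qed.

(** Evaluation at ['X_i] is a left inverse of [poly_in i]. *)
Lemma poly_in_eq0 i f : (poly_in i f == 0) = (f == 0).
Proof.
have ev_X : (horner_eval 'X_i \o poly_in i) =1 idfun.
  apply: mpoly_rmorph_ext => [c|j] /=; rewrite /horner_eval ?poly_inC ?hornerC //.
  by rewrite poly_inX; case: eqP => [->|_]; rewrite ?hornerX ?hornerC.
apply/eqP/eqP => [f0|->]; last exact: raddf0.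
by rewrite -[f]/(idfun f) -ev_X /= /horner_eval f0 horner0.
Qed.

Section Eval.
Context {S : comNzRingType} (h : {rmorphism F -> S}).

Lemma mmap_poly_in i (v w : 'I_n -> S) f :
    (forall j, j != i -> v j = w j) ->
  mmap h v f = (map_poly (mmap h w) (poly_in i f)).[v i].
Proof.
move=> eq_vw.
pose g := horner_eval (v i) \o (map_poly (mmap h w) \o poly_in i).
suff: mmap h v =1 g by apply.
apply: mpoly_rmorph_ext => [c|j]; rewrite /g /= /horner_eval.
  by rewrite poly_inC map_polyC /= !mmapC hornerC.
rewrite poly_inX mmapX mmap1U; case: eqVneq => [->|ji].
  by rewrite map_polyX hornerX.
by rewrite map_polyC hornerC /= mmapX mmap1U eq_vw.
Qed.

Lemma mmap_indep1 i (v w : 'I_n -> S) f :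
    (size (poly_in i f) <= 1)%N -> (forall j, j != i -> v j = w j) ->
  mmap h v f = mmap h w f.
Proof.
move=> /size1_polyC fC eq_vw.
rewrite (mmap_poly_in i v w f eq_vw) (mmap_poly_in i w w f) // fC.
by rewrite map_polyC !hornerC.
Qed.

Lemma mmap_indep (v w : 'I_n -> S) f :
    (forall j, (size (poly_in j f) <= 1)%N \/ v j = w j) ->
  mmap h v f = mmap h w f.
Proof.
move=> indep.
(* The coordinates are changed from [v] to [w] one at a time; [s] lists those that may still
   differ. *)
suff{indep} on_seq (s : seq 'I_n) (u : 'I_n -> S) :
    (forall j, j \in s -> (size (poly_in j f) <= 1)%N \/ u j = w j) ->
    (forall j, j \notin s -> u j = w j) -> mmap h u f = mmap h w f.
  apply: (on_seq (enum 'I_n)) => j; last by rewrite mem_enum.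
  by move=> _; exact: indep.
elim: s u => [|i s IHs] u indep off_s.
  rewrite /mmap; apply: eq_bigr => m _; congr (_ * _).
  by apply: mmap1_eq => j; exact: off_s.
pose u' j := if j == i then w j else u j.
have ->: mmap h u f = mmap h u' f.
  have [szi|ui] := indep i (mem_head _ _).
    by apply: (mmap_indep1 i) => // j ji; rewrite /u' (negPf ji).
  rewrite /mmap; apply: eq_bigr => m _; congr (_ * _).
  by apply: mmap1_eq => j; rewrite /u'; case: eqP => // ->.
apply: IHs => j js; rewrite /u'; case: eqP => [_|/eqP ji]; try by [|right].
  by apply: indep; rewrite inE js orbT.
by apply: off_s; rewrite inE negb_or ji.
Qed.

End Eval.

(** Such an [f] takes the same value at the variables themselves, where it is [f], as at the origin,
    where it is a constant. *)
Lemma unit_of_indep f :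
  f != 0 -> (forall i, (size (poly_in i f) <= 1)%N) -> f \is a GRing.unit.
Proof.
move=> f0 indep.
have fE : f = (mmap idfun (fun=> 0) f)%:MP.
  have idE : idfun =1 mmap (@mpolyC n F) (fun i => 'X_i).
    by apply: mpoly_rmorph_ext => [c|i] /=; rewrite ?mmapC // mmapX mmap1U.
  rewrite -{1}[f]/(idfun f) idE (mmap_indep _ _ (fun=> 0)); last by left.
  apply: (mpoly_rmorph_ext _ _ (@mpolyC n F \o mmap idfun (fun=> 0))) => [c|i] /=.
    by rewrite !mmapC.
  by rewrite !mmapX !mmap1U mpolyC0.
rewrite fE rmorph_unit // unitfE; apply: contraNneq f0 => c0.
by rewrite fE c0 mpolyC0.
Qed.

End PartialDegree.

(** * The form with free coefficients: symmetries and discriminant *)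

Definition Eform {R : comNzRingType} (p q r s x a b c d : R) : R :=
  Epoly (p * a + q * b) (x * a * b) (r * c + s * d) (x * c * d).

Lemma rmorph_Eform (R S : comNzRingType) (g : {rmorphism R -> S})
    (p q r s x a b c d : R) :
  g (Eform p q r s x a b c d) =
  Eform (g p) (g q) (g r) (g s) (g x) (g a) (g b) (g c) (g d).
Proof.
by rewrite /Eform /Epoly !(rmorphD, rmorphN, rmorphM, rmorphXn, rmorph1).
Qed.

Lemma Eform_swap_ab (R : comNzRingType) (p q r s x a b c d : R) :
  Eform q p r s x b a c d = Eform p q r s x a b c d.
Proof. rewrite /Eform /Epoly; ring. Qed.

Lemma Eform_swap_cd (R : comNzRingType) (p q r s x a b c d : R) :
  Eform p q s r x a b d c = Eform p q r s x a b c d.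
Proof. rewrite /Eform /Epoly; ring. Qed.

Lemma Eform_swap_pairs (R : comNzRingType) (p q r s x a b c d : R) :
  Eform r s p q x c d a b = Eform p q r s x a b c d.
Proof. rewrite /Eform /Epoly; ring. Qed.

Lemma Eform_quadratic (R : comNzRingType) (p q r s x a b c : R) :
  exists e0 e1 e2 : R,
  Eform p%:P q%:P r%:P s%:P x%:P a%:P b%:P c%:P 'X
    = e2%:P * 'X^2 + e1%:P * 'X + e0%:P
  /\ e1 ^+ 2 - 4 * e2 * e0
    = ((p * a + q * b) ^+ 2 - 4 * x * a * b)
      * (x * (r * c ^+ 2 - (p * a + q * b) * c + s * a * b)) ^+ 2.
Proof.
pose A1 := p * a + q * b; pose A2 := x * a * b.
exists (A2 * (r ^+ 2 * c ^+ 2 - A1 * r * c + A2)).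
exists (- A1 * r * x * c ^+ 2 + x * c * (A1 ^+ 2 - 2 * A2)
        + 2 * r * s * c * A2 - s * A1 * A2).
exists (x ^+ 2 * c ^+ 2 - A1 * s * x * c + A2 * s ^+ 2).
rewrite /A2 /A1 /Eform /Epoly; split; ring.
Qed.

Lemma size2_polyE (R : nzRingType) (w : {poly R}) :
  (size w <= 2)%N -> w = (w`_1)%:P * 'X + (w`_0)%:P.
Proof.
move=> szw; apply/polyP => -[|[|k]]; rewrite coefD coefMX !coefC ?add0r ?addr0 //=.
by rewrite nth_default // (leq_trans szw).
Qed.

(** The root [t] is, up to sign, the resultant of the two linear factors. Leading coefficients may
    vanish, as can happen after a specialization. *)
Lemma disc_mul_linear (R : comNzRingType) (u v : {poly R}) (e0 e1 e2 : R) :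
    (size u <= 2)%N -> (size v <= 2)%N ->
    u * v = e2%:P * 'X^2 + e1%:P * 'X + e0%:P ->
  exists t : R, e1 ^+ 2 - 4 * e2 * e0 = t ^+ 2.
Proof.
move=> /size2_polyE -> /size2_polyE ->; move: u`_1 u`_0 v`_1 v`_0 => u1 u0 v1 v0 uvE.
have {}uvE : (u1 * v1)%:P * 'X^2 + (u1 * v0 + u0 * v1)%:P * 'X + (u0 * v0)%:P
    = e2%:P * 'X^2 + e1%:P * 'X + e0%:P.
  by rewrite -uvE; ring.
have coefs k := congr1 (fun w : {poly R} => w`_k) uvE.
move: (coefs 0) (coefs 1%N) (coefs 2%N).
rewrite !coefD !coefCM !coefXn !coefX !coefC /=.
rewrite !(mulr0, mulr1, add0r, addr0) => <- <- <-.
exists (u1 * v0 - u0 * v1); ring.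
Qed.

(** * Each variable occurs in at most one factor *)

Section Discriminant.
Context {F : fieldType} (p q r s x : F).
Hypotheses (two_neq0 : 2%:R != 0 :> F) (x_neq0 : x != 0) (pq_neq_x : p * q != x).
Hypothesis pqrs_neq0 : ~~ [&& p == 0, q == 0, r == 0 & s == 0].

(* The discriminant of [Eform] in [d], at [a = t], [b = 1], [c = t^3]: the
   exponents 6, 4, 3, 1 of the second factor are distinct, so it is nonzero. *)
Lemma disc_not_square (w : {poly F}) :
  ((p%:P * 'X + q%:P) ^+ 2 - 4 * x%:P * 'X)
    * (x%:P * (r%:P * 'X^6 - (p%:P * 'X + q%:P) * 'X^3 + s%:P * 'X)) ^+ 2
  != w ^+ 2.
Proof.
set D := (_ ^+ 2 - _); set N := x%:P * _; apply/eqP => DN.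
have N_neq0 : N != 0.
  rewrite mulf_neq0 ?polyC_eq0 //; apply: contraNneq pqrs_neq0.
  have ->: r%:P * 'X^6 - (p%:P * 'X + q%:P) * 'X^3 + s%:P * 'X
      = r%:P * 'X^6 - p%:P * 'X^4 - q%:P * 'X^3 + s%:P * 'X by ring.
  move=> N0; have coefs k := congr1 (fun w : {poly F} => w`_k) N0.
  move: (coefs 1%N) (coefs 3%N) (coefs 4%N) (coefs 6%N).
  rewrite !(coefD, coefN) !coefCM !coefXn !coefX !coef0 /=.
  rewrite !(mulr0, mulr1, add0r, addr0, subr0, oppr0).
  move=> -> /eqP; rewrite oppr_eq0 => /eqP -> /eqP; rewrite oppr_eq0 => /eqP -> ->.
  by rewrite eqxx.
(* Over a field, [N ^+ 2] dividing [w ^+ 2] forces [N] to divide [w]; cancelling then makes [D]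
   itself a square. *)
have /dvdpP[v wE] : N %| w.
  by rewrite -(@dvdp_pexp2r _ _ _ 2) // -DN dvdp_mull.
have {DN}DE : D = v ^+ 2.
  apply: (mulIf (expf_neq0 2 N_neq0)); rewrite DN wE; ring.
have D3 : (size D <= 3)%N.
  have ->: D = (p ^+ 2)%:P * 'X^2 + (2 * p * q - 4 * x)%:P * 'X + (q ^+ 2)%:P.
    by rewrite /D; ring.
  apply/leq_sizeP => j j3; rewrite !coefD !coefCM coefXn coefX coefC.
  by case: j j3 => [|[|[|j]]] //= _; rewrite !mulr0 !addr0.
have v2 : (size v <= 2)%N.
  have [->|v0] := eqVneq v 0; first by rewrite size_poly0.
  move: D3; rewrite DE expr2 size_mul //.
  by case: (size v) => [|[|[|k]]] //; rewrite !addSn !addnS.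
have vv : v * v = (p ^+ 2)%:P * 'X^2 + (2 * p * q - 4 * x)%:P * 'X + (q ^+ 2)%:P.
  by rewrite -expr2 -DE /D; ring.
move: vv; rewrite (size2_polyE _ _ v2); move: v`_1 v`_0 => v1 v0 vv.
have {}vv : (v1 ^+ 2)%:P * 'X^2 + (2 * v1 * v0)%:P * 'X + (v0 ^+ 2)%:P
   = (p ^+ 2)%:P * 'X^2 + (2 * p * q - 4 * x)%:P * 'X + (q ^+ 2)%:P.
  by rewrite -vv; ring.
have coefs k := congr1 (fun w : {poly F} => w`_k) vv.
move: (coefs 0) (coefs 1%N) (coefs 2%N).
rewrite !coefD !coefCM !coefXn !coefX !coefC /=.
rewrite !(mulr0, mulr1, add0r, addr0) => E0 E1 E2.
(* This is the discriminant of [D], which vanishes since [D] is the square of a linear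
   polynomial. *)
have: 2 ^+ 4 * (x * (x - p * q)) = 0.
  have ->: 2 ^+ 4 * (x * (x - p * q))
      = (2 * p * q - 4 * x) ^+ 2 - 4 * p ^+ 2 * q ^+ 2 by ring.
  by rewrite -E0 -E1 -E2; ring.
apply/eqP; rewrite mulf_neq0 ?expf_neq0 // mulf_neq0 //.
by rewrite subr_eq0 eq_sym.
Qed.

Lemma Eform_split n (i1 i2 i3 i4 : 'I_n) (f g : {mpoly F[n]}) :
    uniq [:: i1; i2; i3; i4] -> f != 0 -> g != 0 ->
    Eform p%:MP q%:MP r%:MP s%:MP x%:MP 'X_i1 'X_i2 'X_i3 'X_i4 = f * g ->
  (size (poly_in i4 f) <= 1)%N \/ (size (poly_in i4 g) <= 1)%N.
Proof.
rewrite /= !inE !negb_or => /and4P[/and3P[i12 i13 i14] /andP[i23 i24] i34 _].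
move=> f0 g0 Efg; set u := poly_in i4 f; set v := poly_in i4 g.
have u0 : u != 0 by rewrite poly_in_eq0.
have v0 : v != 0 by rewrite poly_in_eq0.
have uvE : u * v = Eform p%:MP%:P q%:MP%:P r%:MP%:P s%:MP%:P x%:MP%:P
                     ('X_i1)%:P ('X_i2)%:P ('X_i3)%:P 'X.
  rewrite /u /v -rmorphM -Efg rmorph_Eform /= !poly_inC !poly_inX eqxx.
  by rewrite (negPf i14) (negPf i24) (negPf i34).
clearbody u v.
have uv3 : (size (u * v)%R <= 3)%N.
  rewrite uvE.
  have [e0 [e1 [e2 [-> _]]]] :=
    Eform_quadratic _ p%:MP q%:MP r%:MP s%:MP x%:MP 'X_i1 'X_i2 'X_i3.
  apply/leq_sizeP => j j3; rewrite !coefD !coefCM coefXn coefX coefC.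
  by case: j j3 => [|[|[|j]]] //= _; rewrite !mulr0 !addr0.
(* Both factors are nonzero, so their sizes add up to at most 4. *)
have [||sz_uv] :
    [\/ (size u <= 1)%N, (size v <= 1)%N | (size u <= 2)%N /\ (size v <= 2)%N].
  rewrite size_mul // in uv3.
  move: (size u) (size v) uv3 => [|[|[|k]]] [|[|[|l]]] //;
    rewrite ?addSn ?addnS; by [constructor|].
- by left.
- by right.
(* Only the values at [i1], [i2], [i3] matter: the coefficients of [u * v] do not involve
   ['X_i4]. *)
pose pt j : {poly F} := if j == i1 then 'X else if j == i2 then 1 else 'X^3.
pose ev := map_poly (mmap (@polyC F) pt).
have uvE' : ev u * ev v
    = Eform p%:P%:P q%:P%:P r%:P%:P s%:P%:P x%:P%:P ('X)%:P 1%:P ('X^3)%:P 'X.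
  rewrite /ev -rmorphM uvE rmorph_Eform /= !map_polyC map_polyX /= !mmapC !mmapX.
  rewrite !mmap1U /pt eqxx [i2 == i1]eq_sym (negPf i12) eqxx.
  by rewrite [i3 == i1]eq_sym (negPf i13) [i3 == i2]eq_sym (negPf i23).
have [e0 [e1 [e2 [EE discE]]]] :=
  Eform_quadratic _ p%:P q%:P r%:P s%:P x%:P 'X 1 'X^3.
have [|||w dw] := @disc_mul_linear _ (ev u) (ev v) e0 e1 e2.
- exact: leq_trans (size_poly _ _) sz_uv.1.
- exact: leq_trans (size_poly _ _) sz_uv.2.
- by rewrite uvE' EE.
case/eqP: (disc_not_square w); rewrite -dw discE; ring.
Qed.

End Discriminant.

(** * Roots of unity and the irreducibility argument *)

Lemma linear_coefs_mul_neq (F : fieldType) (x y : F) :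
  x != 1 -> y != 0 -> y != 1 -> (y - x) / (y - 1) * ((x * y - 1) / (y - 1)) != x.
Proof.
move=> x1 y0 y1; have y1' : y - 1 != 0 by rewrite subr_eq0.
rewrite -subr_eq0.
have ->: (y - x) / (y - 1) * ((x * y - 1) / (y - 1)) - x
    = - (y * (x - 1) ^+ 2) / (y - 1) ^+ 2 by field.
rewrite mulf_neq0 ?invr_eq0 ?expf_neq0 // oppr_eq0.
by rewrite mulf_neq0 ?expf_neq0 // subr_eq0.
Qed.

Lemma root_of_unity1_neq0 (x : algC) : is_root_of_unity1 x -> x != 0.
Proof.
case=> n [n0 xn]; apply: contraTneq isT => x0; move: xn.
by rewrite x0 expr0n eqn0Ngt n0 => /esym/eqP; rewrite oner_eq0.
Qed.

Theorem theoremA2 (x y z : algC) :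
  is_root_of_unity1 x -> is_root_of_unity1 y -> is_root_of_unity1 z ->
  x != 1 -> y != 1 -> z != 1 ->
  ~ (x = -1 /\ y = -1 /\ z = -1) ->
  irreducible_elt (Estar x y z).
Proof.
move=> /root_of_unity1_neq0 x0 /root_of_unity1_neq0 y0 /root_of_unity1_neq0 z0.
move=> x1 y1 z1 not_all_m1.
set p := (y - x) / (y - 1); set q := (x * y - 1) / (y - 1).
set r := (z - x) / (z - 1); set s := (x * z - 1) / (z - 1).
have pq : p * q != x by exact: linear_coefs_mul_neq.
have rs : r * s != x by exact: linear_coefs_mul_neq.
have qp : q * p != x by rewrite mulrC.
have sr : s * r != x by rewrite mulrC.
have two0 : 2%:R != 0 :> algC by rewrite pnatr_eq0.
have pqrs : ~~ [&& p == 0, q == 0, r == 0 & s == 0].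
  (* From [p = 0] and [r = 0] come [y = x] and [z = x]; then [q = 0] gives [x ^+ 2 = 1]. *)
  apply/negP => /and4P[+ + + _].
  rewrite !mulf_eq0 !invr_eq0 !subr_eq0 (negPf y1) (negPf z1) !orbF.
  move=> /eqP yx /eqP xy1 /eqP zx; apply: not_all_m1; rewrite yx zx.
  suff /eqP ->: x == -1 by [].
  move: xy1; rewrite yx -expr2 => /eqP; rewrite sqrf_eq1 (negPf x1) //.
have EE : Estar x y z = Eform p%:MP q%:MP r%:MP s%:MP x%:MP va vb vc vd by [].
have evE (w : 'I_4 -> algC) : (Estar x y z).@[w]
    = Eform p q r s x (w (inord 0)) (w (inord 1)) (w (inord 2)) (w (inord 3)).
  by rewrite EE /meval rmorph_Eform /= !mmapC /va /vb /vc /vd !mmapX !mmap1U.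
pose P (j : 'I_4) : algC := (j < 2)%N%:R.
pose P' (j : 'I_4) : algC := (2 <= j)%N%:R.
(* At [P] only the term [A2 ^+ 2] survives, at [P'] only [B2 ^+ 2]. *)
have EP : (Estar x y z).@[P] != 0.
  rewrite evE /P !inordK //= /Eform /Epoly.
  by rewrite [X in X != 0](_ : _ = x ^+ 2) ?expf_neq0 //; ring.
have EP' : (Estar x y z).@[P'] != 0.
  rewrite evE /P' !inordK //= /Eform /Epoly.
  by rewrite [X in X != 0](_ : _ = x ^+ 2) ?expf_neq0 //; ring.
have E0 : Estar x y z != 0 by apply: contraNneq EP => ->; rewrite meval0.
split=> //; split.
  (* A unit would have a nonzero value at the origin. *)
  apply/negP => /(rmorph_unit (meval (fun=> 0))) /=.
  rewrite evE [X in X \is a _](_ : _ = 0) ?unitr0 // /Eform /Epoly; ring.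
move=> f g Efg.
have f0 : f != 0 by apply: contraNneq E0 => f0; rewrite Efg f0 mul0r.
have g0 : g != 0 by apply: contraNneq E0 => g0; rewrite Efg g0 mulr0.
(* The symmetries of [Eform] move each variable in turn to the last place, permuting [p], [q], [r],
   [s] accordingly. *)
have split_vars (j : 'I_4) :
    (size (poly_in j f) <= 1)%N \/ (size (poly_in j g) <= 1)%N.
  have jE : j \in [:: inord 0; inord 1; inord 2; inord 3].
    by rewrite !inE -!val_eqE /= !inordK //; case: j => -[|[|[|[]]]].
  move: Efg; rewrite EE => Efg; move: jE; rewrite !inE => /or4P[] /eqP ->.
  - apply: (Eform_split r s q p x _ _ _ _ _ (inord 2) (inord 3) (inord 1)) => //.
    + by apply: contra pqrs => /and4P[-> -> -> ->].
    + by rewrite /= !inE -!val_eqE /= !inordK.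
    + by rewrite Eform_swap_pairs Eform_swap_ab.
  - apply: (Eform_split r s p q x _ _ _ _ _ (inord 2) (inord 3) (inord 0)) => //.
    + by apply: contra pqrs => /and4P[-> -> -> ->].
    + by rewrite /= !inE -!val_eqE /= !inordK.
    + by rewrite Eform_swap_pairs.
  - apply: (Eform_split p q s r x _ _ _ _ _ (inord 0) (inord 1) (inord 3)) => //.
    + by apply: contra pqrs => /and4P[-> -> -> ->].
    + by rewrite /= !inE -!val_eqE /= !inordK.
    + by rewrite Eform_swap_cd.
  - apply: (Eform_split p q r s x _ _ _ _ _ (inord 0) (inord 1) (inord 2)) => //.
    by rewrite /= !inE -!val_eqE /= !inordK.
pose B (j : 'I_4) := (size (poly_in j g) <= 1)%N.
have fB j : ~~ B j -> (size (poly_in j f) <= 1)%N.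
  by case: (split_vars j) => [fj _|gj /negP[]]; [exact: fj | exact: gj].
(* Since [f] sees only the variables in [B] and [g] only the others, [f] reads [v] and [g] reads [w]
   at this point. *)
pose mix (v w : 'I_4 -> algC) j := if B j then v j else w j.
have mixE v w : (Estar x y z).@[mix v w] = f.@[v] * g.@[w].
  rewrite Efg rmorphM; congr (_ * _); apply: mmap_indep => j; rewrite /mix.
    by case: (boolP (B j)) => [_|/fB fj]; [right | left; exact: fj].
  by case: (boolP (B j)) => [gj|_]; [left; exact: gj | right].
have: (Estar x y z).@[mix P P'] * (Estar x y z).@[mix P' P] != 0.
  by rewrite !mixE mulrACA [g.@[P'] * _]mulrC mulrACA -!rmorphM -Efg mulf_neq0.
have allB (b : bool) : B (inord 0) = b -> B (inord 1) = b -> B (inord 2) = b ->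
    B (inord 3) = b -> forall j, B j = b.
  move=> b0 b1 b2 b3 j.
  have: j \in [:: inord 0; inord 1; inord 2; inord 3].
    by rewrite !inE -!val_eqE /= !inordK //; case: j => -[|[|[|[]]]].
  by rewrite !inE => /or4P[] /eqP ->.
rewrite !evE /mix /P /P' !inordK //=.
(* In the 14 mixed cases one of the two points has [a b = c d = 0], and every term of [Epoly]
   contains [A2] or [B2]. In the two remaining cases one factor involves no variable. *)
case b0: (B (inord 0)); case b1: (B (inord 1)); case b2: (B (inord 2));
  case b3: (B (inord 3)) => /=;
  try by rewrite [X in X != 0](_ : _ = 0) ?eqxx // /Eform /Epoly; ring.
- by right; apply: unit_of_indep g0 _ => j; exact: (allB true).
- by left; apply: unit_of_indep f0 _ => j; apply: fB; rewrite (allB false).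
Qed.
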